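(* There exist absolute constants $c_1,c_2>0$ with the following property. Let $S$ be the set of $m\in\mathbb{N}$ such that for all integers $k$ with $0\le k\le \exp(c_1\sqrt{\log m})$ and for all primes $p$, \[ \nu_p\!\left(\binom{2m}{m}\right)-\nu_p\!\left(\binom{m+k}{m}\right)\ \ge\ c_2\,\frac{\log m}{\log p}\cdot[\,p\le 2k\,]. \] Then $S$ has asymptotic density $1$.
   Context: $\nu_p$ denotes the $p$-adic valuation. $[\,p\le 2k\,]$ is the Iverson bracket: it equals $1$ if $p\le 2k$ and $0$ otherwise. $\log$ is the natural logarithm. *)

(* Defs.v *)
(* Library world: MathComp / MathComp-Analysis. *)
From mathcomp Require Import all_boot all_order all_algebra.
From mathcomp Require Import all_classical all_reals all_analysis.
Set Implicit Arguments.
Unset Strict Implicit.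
Unset Printing Implicit Defensive.
Import Order.TTheory GRing.Theory Num.Theory.
Import numFieldNormedType.Exports.
Local Open Scope classical_set_scope.
Local Open Scope ring_scope.

Definition counting_function (A : set nat) (N : nat) : nat :=
  (\sum_(1 <= m < N.+1) (m \in A))%N.

(* The value of the ratio at N = 0 is 0 / 0 = 0 and does not affect the limit. *)
Definition has_asymptotic_density (R : realType) (A : set nat) (d : R) : Prop :=
  ((counting_function A N)%:R / N%:R : R) @[N --> \oo] --> d.

(* Natural numbers are taken positive here, so that [ln m] is the true
   logarithm.  [logn p n] is the p-adic valuation of [n > 0] for prime [p]; the
   valuations are subtracted in [R], so the difference is not truncated.  The
   coercion of the boolean [(p <= 2 * k)%N] to 0 or 1 is the Iverson bracket. *)
Definition valuation_gap_set (R : realType) (c1 c2 : R) : set nat :=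
  [set m : nat | (0 < m)%N /\
    forall k : nat, k%:R <= expR (c1 * Num.sqrt (ln (m%:R : R))) ->
    forall p : nat, prime p ->
      (logn p 'C(2 * m, m))%:R - (logn p 'C(m + k, m))%:R
        >= c2 * (ln m%:R / ln p%:R) * ((p <= 2 * k)%N)%:R].

(* Main.v *)
(* By Kummer's theorem both valuations count carries in base p.  If 2k < p, every
   carry of m + k is a carry of m + m, so the gap is nonnegative for all m.  If
   p <= 2k <= 2K with K = exp(c1 sqrt(log N)), take M of order log N / log p with
   N < p^(16M).  Then m + k has at most M carries unless m mod p^M >= p^M - K, and
   m + m has at least 2M carries outside a proportion 4^-M of the residues mod
   p^(16M), by an exponential moment bound.  Since M is at least of order
   log N / log (2K), the factor 2^-M beats the powers of K that are lost in the
   union bound over p <= 2K once c1 is small. *)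
Require Import Defs.
From mathcomp Require Import all_boot all_order all_algebra.
From mathcomp Require Import all_classical all_reals all_analysis.
From mathcomp Require Import zify ring lra.
Import Order.TTheory GRing.Theory Num.Theory.
Import numFieldNormedType.Exports.

(** * Carries in base [p] and binomial valuations *)

Lemma logn_fact_trunc p n B :
  prime p -> n <= B -> logn p n`! = \sum_(1 <= j < B.+1) n %/ p ^ j.
Proof.
move=> p_pr le_nB; rewrite logn_fact // (@big_cat_nat _ _ _ n.+1 1 B.+1) //=.
rewrite [X in _ = _ + X]big_nat_cond [X in _ = _ + X]big1 ?addn0 // => j.
rewrite andbT => /andP[lt_nj _]; apply/divn_small/(ltn_trans lt_nj).
exact/ltn_expl/prime_gt1.
Qed.

(** The summand at [j] is the carry out of digit [j]. The cutoff [D] lets the same count serve for a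
    full addition and for its lowest digits. *)
Definition carries p a b D :=
  \sum_(0 <= j < D) (p ^ j.+1 <= a %% p ^ j.+1 + b %% p ^ j.+1).

(* Kummer's theorem, via Legendre's formula. *)
Lemma logn_bin_carries p a b B :
  prime p -> a + b <= B -> logn p 'C(a + b, a) = carries p a b B.
Proof.
move=> p_pr le_B; have p_gt0 := prime_gt0 p_pr.
have /(congr1 (logn p)) := bin_fact (leq_addr b a).
rewrite addKn !lognM ?muln_gt0 ?fact_gt0 ?bin_gt0 ?leq_addr //.
rewrite !(@logn_fact_trunc p _ B) // ?(leq_trans _ le_B) ?leq_addr ?leq_addl //.
under [RHS]eq_bigr => j _ do rewrite divnD ?expn_gt0 ?p_gt0 //.
by rewrite !big_split /= addnC => /addnI ->; rewrite big_add1.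
Qed.

Lemma leq_carries p a b D E : D <= E -> carries p a b D <= carries p a b E.
Proof. by move=> le_DE; rewrite /carries (big_cat_nat _ le_DE) //= leq_addr. Qed.

(** A carry of [m + k] at modulus $q \ge p > 2k$ forces $m \bmod q \ge q - k > q/2$, so doubling [m]
    carries there too. *)
Lemma carries_small p m k D : 2 * k < p -> carries p m k D <= carries p m m D.
Proof.
move=> lt_kp; apply: leq_sum => j _.
have le_pq : p <= p ^ j.+1 by rewrite expnS leq_pmulr // expn_gt0; lia.
rewrite (modn_small (_ : k < _)); last by lia.
by case: (leqP _ (_ + k)) => // ?; case: leqP => //; lia.
Qed.

(** The addition stays inside the lowest [M] digits, so no carry leaves any position from [M] on. *)
Lemma carries_low p m k M D : 0 < p ->
  m %% p ^ M + k < p ^ M -> carries p m k D <= M.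
Proof.
move=> p_gt0 low; apply: leq_trans (_ : carries p m k (maxn D M) <= M).
  by rewrite leq_carries ?leq_maxl.
rewrite /carries (@big_cat_nat _ _ _ M) ?leq_maxr //=.
rewrite [X in _ + X]big_nat_cond [X in _ + X]big1 ?addn0 => [|j].
  apply: leq_trans (_ : \sum_(0 <= j < M) 1 <= M).
    by apply: leq_sum => j _; case: (p ^ _ <= _).
  by rewrite sum_nat_const_nat subn0 muln1.
rewrite andbT => /andP[le_Mj _].
have pM_gt0 : 0 < p ^ M by rewrite expn_gt0 p_gt0.
have dvq : p ^ M %| p ^ j.+1 by rewrite dvdn_exp2l // leqW.
set q := p ^ j.+1 in dvq *.
have q_gt0 : 0 < q by rewrite expn_gt0 p_gt0.
(* With $m \bmod q = u p^M + (m \bmod p^M)$ and $q = v p^M$, $u < v$, adding [k] stays below $(u+1)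
   p^M \le q$. *)
rewrite (divn_eq (m %% q) (p ^ M)).
have := ltn_pmod m q_gt0; rewrite -{2}(divnK dvq) -ltn_divLR //.
set u := _ %/ _; set v := q %/ _ => lt_uv.
have kmod : k %% q <= k by rewrite leq_mod.
rewrite modn_dvdm //; apply/eqP; rewrite eqb0 -ltnNge.
have : u.+1 * p ^ M <= v * p ^ M by rewrite leq_mul2r lt_uv orbT.
by rewrite mulSn (divnK dvq) => ?; lia.
Qed.

(** * Large deviations for the carries of [m + m] *)

Definition noncarries p m D := \sum_(0 <= j < D) (2 * (m %% p ^ j.+1) < p ^ j.+1).

Lemma carries_noncarries p m D : carries p m m D + noncarries p m D = D.
Proof.
rewrite -big_split /= -[RHS]muln1 -[X in X * 1](subn0 D) -sum_nat_const_nat.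
by apply: eq_bigr => j _; rewrite addnn -mul2n; case: ltnP.
Qed.

Lemma sum_nat_mul a q (F : nat -> nat) :
  \sum_(0 <= i < a * q) F i = \sum_(0 <= d < a) \sum_(0 <= r < q) F (d * q + r).
Proof.
rewrite big_nat_mul; apply: eq_bigr => d _.
rewrite -{1}[d * q]add0n big_addn mulSn addnK.
by apply: eq_bigr => r _; rewrite addnC.
Qed.

Lemma sum_ltn n h : \sum_(0 <= d < n) (d < h) = minn n h.
Proof.
elim: n => [|n IHn]; first by rewrite big_nil min0n.
by rewrite big_nat_recr //= IHn; lia.
Qed.

(** Exactly [uphalf p] digits have weight 2 and the others weight 1; [uphalf p] is at most $2p/3$,
    with equality at $p = 3$, so the mean weight is at most $5/3$. *)
Lemma sum_exp_low_digit p : 1 < p ->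
  3 * (\sum_(0 <= d < p) 2 ^ (2 * d < p)) <= 5 * p.
Proof.
move=> p_gt1; rewrite (eq_bigr (fun d => 1 + (d < uphalf p))) => [|d _].
  by rewrite big_split /= sum_nat_const_nat sum_ltn; lia.
rewrite (_ : (2 * d < p) = (d < uphalf p)); first by case: ltnP.
by lia.
Qed.

(** Lower positions do not see the top digit [d], and a non-carry at the top forces $2d < p$. The
    converse can fail because of [r], hence an inequality. *)
Lemma noncarriesS p d r D : d < p -> r < p ^ D ->
  noncarries p (d * p ^ D + r) D.+1 <= noncarries p r D + (2 * d < p).
Proof.
move=> lt_d lt_r; have p_gt0 : 0 < p ^ D by case: (p ^ D) lt_r.
rewrite /noncarries big_nat_recr //=; apply: leq_add.
  rewrite big_nat_cond [leqRHS]big_nat_cond; apply: leq_sum => j /andP[/andP[_ lt_jD] _].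
  by rewrite -modnDml -{1}(subnK lt_jD) expnD mulnA modnMl add0n.
have le_d : d.+1 * p ^ D <= p * p ^ D by rewrite leq_mul2r lt_d orbT.
rewrite mulSn in le_d.
rewrite expnS modn_small; last by lia.
case: (ltnP (2 * d)) => [_|le_p]; first by case: (_ < _).
have : p * p ^ D <= 2 * d * p ^ D by rewrite leq_mul2r le_p orbT.
by rewrite -mulnA => ?; case: ltnP => //; lia.
Qed.

(* With base-p digits uniform and independent, this is the exponential moment
   of the number of non-carries: a single digit d satisfies 2 d < p with
   probability at most 2/3. *)
Lemma sum_exp_noncarries p D : 1 < p ->
  3 ^ D * (\sum_(0 <= m < p ^ D) 2 ^ noncarries p m D) <= (5 * p) ^ D.
Proof.
move=> p_gt1; elim: D => [|D IHD].
  by rewrite !expn0 big_nat1 /noncarries big_nil.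
rewrite [p ^ _]expnS sum_nat_mul.
apply: leq_trans (_ : 3 ^ D.+1 * (\sum_(0 <= d < p) 2 ^ (2 * d < p) *
    \sum_(0 <= r < p ^ D) 2 ^ noncarries p r D) <= _).
  rewrite leq_mul2l orbC big_nat_cond [leqRHS]big_nat_cond.
  rewrite leq_sum // => d /andP[/andP[_ lt_d] _].
  rewrite big_distrr /= big_nat_cond [leqRHS]big_nat_cond leq_sum //.
  move=> r /andP[/andP[_ lt_r] _].
  by rewrite -expnD leq_pexp2l // [leqRHS]addnC noncarriesS.
rewrite -big_distrl /= !expnS mulnACA leq_mul // sum_exp_low_digit //.
Qed.

(** Markov's inequality: fewer than [2 * M] carries among [16 * M] digits means more than [14 * M]
    non-carries, so the proportion is at most $(5/3)^{16M} 2^{-14M} = (5/6)^{16M} 4^M$. *)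
Lemma count_few_carries p M : 1 < p ->
  4 ^ M * (\sum_(0 <= m < p ^ (16 * M)) (carries p m m (16 * M) < 2 * M))
    <= p ^ (16 * M).
Proof.
move=> p_gt1; set D := 16 * M; set B := (X in _ * X <= _).
have : 2 ^ (14 * M) * B <= \sum_(0 <= m < p ^ D) 2 ^ noncarries p m D.
  rewrite big_distrr leq_sum //= => m _.
  case: ltnP; rewrite ?muln0 // muln1 => few.
  by rewrite leq_pexp2l //; have := carries_noncarries p m D; lia.
move=> few; have {few} few : 3 ^ D * (2 ^ (14 * M) * B) <= (5 * p) ^ D.
  by apply: leq_trans (sum_exp_noncarries _ _ p_gt1); rewrite leq_mul2l few orbT.
have leq_wexp2r a b e : a <= b -> a ^ e <= b ^ e.
  by case: e => [|e] le_ab; rewrite ?expn0 ?leq_exp2r.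
(* Since $2 \cdot 5^4 \le 6^4$, the factor $(5/6)^{16M}$ is at most $16^{-M}$. *)
have low : 5 ^ D * 16 ^ M <= 6 ^ D.
  have := leq_wexp2r (5 ^ 4 * 2) (6 ^ 4) (4 * M) isT.
  by rewrite expnMn -!expnM !mulnA [2 ^ _]expnM.
have e16 : 16 ^ M = 4 ^ M * 4 ^ M by rewrite -expnMn.
have e6 : 6 ^ D = 3 ^ D * (2 ^ (14 * M) * 4 ^ M).
  by rewrite (expnMn 2 3) mulnC -(expnM 2 2) -expnD; congr (_ * 2 ^ _); lia.
rewrite -(leq_pmul2l (expn_gt0 6 D : 0 < 6 ^ D)).
apply: leq_trans (leq_mul low (leqnn (p ^ D))).
have -> : 5 ^ D * 16 ^ M * p ^ D = 4 ^ M * 4 ^ M * (5 * p) ^ D.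
  by rewrite e16 (expnMn 5); ring.
apply: leq_trans (_ : 4 ^ M * 4 ^ M * (3 ^ D * (2 ^ (14 * M) * B)) <= _); last first.
  by rewrite leq_mul2l few orbT.
by rewrite e6; apply/eq_leq; ring.
Qed.

(** * Bad residues for one prime *)

Definition good p M K m :=
  (m %% p ^ M + K < p ^ M) && (2 * M <= carries p m m (16 * M)).

(** The first condition fails for at most [K] residues modulo $p^M$, a proportion of at most
    $K/2^M$; the second fails with proportion at most $4^{-M} \le 2^{-M}$. *)
Lemma count_bad p M K : 1 < p ->
  2 ^ M * (\sum_(0 <= m < p ^ (16 * M)) ~~ good p M K m) <= K.+1 * p ^ (16 * M).
Proof.
move=> p_gt1.
have high : \sum_(0 <= m < p ^ (16 * M)) (p ^ M <= m %% p ^ M + K)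
    <= p ^ (15 * M) * K.
  rewrite (_ : 16 * M = 15 * M + M) ?(expnD p (15 * M)); last by lia.
  rewrite sum_nat_mul.
  apply: leq_trans (_ : \sum_(0 <= d < p ^ (15 * M)) K <= _); last first.
    by rewrite sum_nat_const_nat subn0.
  rewrite leq_sum // => d _; set q := p ^ M.
  apply: leq_trans (_ : \sum_(0 <= r < q) (q <= r + K) <= K).
    rewrite big_nat_cond [leqRHS]big_nat_cond leq_sum // => r.
    by rewrite andbT => /andP[_ lt_r]; rewrite modnMDl modn_small.
  have tail n : \sum_(0 <= r < n) (q <= r + K) <= n + K - q.
    by elim: n => [|n IHn]; rewrite ?big_nil // big_nat_recr //=; lia.
  by have := tail q; rewrite addKn.
have few := count_few_carries p M p_gt1.
have le24 : 2 ^ M <= 4 ^ M by case: M {high few} => // M; rewrite leq_exp2r.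
have lepM : 2 ^ M <= p ^ M by case: M {high few le24} => // M; rewrite leq_exp2r.
apply: leq_trans (_ : 2 ^ M * (\sum_(0 <= m < p ^ (16 * M))
  ((carries p m m (16 * M) < 2 * M) + (p ^ M <= m %% p ^ M + K))) <= _).
  rewrite leq_mul2l leq_sum ?orbT // => m _; rewrite /good negb_and -leqNgt -ltnNge.
  by case: (p ^ M <= _); case: (carries _ _ _ _ < _).
rewrite big_split /= mulnDr mulSn leq_add ?(leq_trans _ few) ?leq_mul2r ?le24 ?orbT //.
apply: leq_trans (leq_mul lepM high) _.
by rewrite mulnA -expnD mulnC [M + _]addnC -mulSnr.
Qed.

(** * Number of digits and union bound over primes *)

Definition ndig p N := (trunc_log p N %/ 16).+1.

(** A full residue system modulo [p ^ (16 * ndig p N)] covers all [m] up to [N], and rounding to a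
    multiple of 16 digits costs at most a factor $p^{16}$. *)
Lemma ndig_bounds p N : 1 < p -> 0 < N ->
  N < p ^ (16 * ndig p N) <= N * p ^ 16.
Proof.
move=> p_gt1 N_gt0; have /andP[le_N lt_N] := trunc_log_bounds p_gt1 N_gt0.
apply/andP; split.
  by apply: leq_trans lt_N _; rewrite leq_pexp2l ?(ltnW p_gt1) // /ndig; lia.
rewrite /ndig mulnS addnC expnD leq_mul2r (leq_trans _ le_N) ?orbT //.
by rewrite leq_pexp2l ?(ltnW p_gt1) //; lia.
Qed.

Lemma leq_ndig p q N : 1 < p -> p <= q -> 0 < N -> ndig q N <= ndig p N.
Proof.
move=> p_gt1 le_pq N_gt0; rewrite ltnS leq_div2r // trunc_log_max //.
have q_gt1 := leq_trans p_gt1 le_pq.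
apply: leq_trans (trunc_logP q_gt1 N_gt0).
by case: trunc_log => // e; rewrite leq_exp2r.
Qed.

Definition all_good N K m :=
  all (fun p => prime p ==> good p (ndig p N) K m) (index_iota 1 (2 * K).+1).

(** The exponent 18 collects $p^{16} \le (2K)^{16}$ from the rounding, $K + 1 \le 2K$ from
    [count_bad], and at most $2K$ primes. By [leq_ndig], the base [2 * K] gives the worst
    exponent. *)
Lemma count_not_all_good N K : 0 < N -> 0 < K ->
  2 ^ ndig (2 * K) N * (\sum_(1 <= m < N.+1) ~~ all_good N K m)
    <= (2 * K) ^ 18 * N.
Proof.
move=> N_gt0 K_gt0; set mu := ndig _ N.
have per_p p : prime p -> p <= 2 * K ->
    2 ^ mu * (\sum_(1 <= m < N.+1) ~~ good p (ndig p N) K m) <= (2 * K) ^ 17 * N.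
  move=> /prime_gt1 p_gt1 le_p; have p_gt0 := ltnW p_gt1.
  have /andP[lt_N le_N] := ndig_bounds p N p_gt1 N_gt0.
  apply: leq_trans (_ : K.+1 * (N * p ^ 16) <= _); last first.
    by rewrite expnS [N * _]mulnC mulnA !leq_mul ?leq_exp2r //; lia.
  apply: leq_trans (leq_mul (leqnn K.+1) le_N).
  apply: leq_trans (count_bad p (ndig p N) K p_gt1).
  apply: leq_mul; first by rewrite leq_pexp2l // leq_ndig.
  rewrite [leqRHS](@big_cat_nat _ _ _ N.+1) //= (leq_trans _ (leq_addr _ _)) //.
  by rewrite [leqRHS](@big_cat_nat _ _ _ 1) //= leq_addl.
apply: leq_trans (_ : \sum_(1 <= p < (2 * K).+1) (2 * K) ^ 17 * N <= _); last first.
  by rewrite sum_nat_const_nat subn1 mulnA expnS.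
apply: leq_trans (_ : \sum_(1 <= p < (2 * K).+1 | prime p)
  2 ^ mu * (\sum_(1 <= m < N.+1) ~~ good p (ndig p N) K m) <= _); last first.
  rewrite big_mkcond /= big_nat_cond [leqRHS]big_nat_cond leq_sum // => p.
  by rewrite andbT => /andP[_ le_p]; case: ifP => // p_pr; apply: per_p.
rewrite -big_distrr /= exchange_big /= leq_mul2l leq_sum ?orbT // => m _.
case: (boolP (all_good N K m)) => // /allPn[p p_in].
rewrite negb_imply => /andP[p_pr p_bad].
by rewrite (big_rem p) //= p_pr p_bad.
Qed.

Lemma all_good_gap N K m k p : 0 < N -> k <= K -> prime p -> p <= 2 * k ->
  all_good N K m ->
  logn p 'C(m + k, m) + ndig p N <= logn p 'C(2 * m, m).
Proof.
move=> N_gt0 le_kK p_pr le_p /allP/(_ p).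
rewrite mem_index_iota prime_gt0 // ltnS (leq_trans le_p) ?leq_mul2l // => /(_ isT).
rewrite p_pr => /andP[low many].
rewrite mul2n -addnn (logn_bin_carries _ _ _ (m + k)) //.
(* The cutoff must reach [m + m] for Kummer's theorem and also contain the digits counted in
   [good]. *)
rewrite (logn_bin_carries _ _ _ (maxn (m + m) (16 * ndig p N))) ?leq_maxl //.
have le1 := carries_low p m k (ndig p N) (m + k) (prime_gt0 p_pr).
have {}le1 := le1 (leq_ltn_trans (leq_add (leqnn _) le_kK) low).
have := leq_carries p m m _ _ (leq_maxr (m + m) (16 * ndig p N)).
by lia.
Qed.

Lemma logn_bin_small m k p : prime p -> 2 * k < p ->
  logn p 'C(m + k, m) <= logn p 'C(2 * m, m).
Proof.
move=> p_pr lt_k; rewrite mul2n -addnn.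
rewrite !(logn_bin_carries _ _ _ (m + m + k)) //; try lia.
exact: carries_small.
Qed.

(** * Logarithmic estimates and density *)

Local Open Scope classical_set_scope.
Local Open Scope ring_scope.

Lemma ln_le_ndig (R : realType) (q N : nat) : (1 < q)%N -> (0 < N)%N ->
  ln (N%:R : R) <= 16 * (ndig q N)%:R * ln q%:R.
Proof.
move=> q_gt1 N_gt0; have /andP[lt_N _] := ndig_bounds q N q_gt1 N_gt0.
have q_gt0 : 0 < q%:R :> R by rewrite ltr0n; lia.
have -> : 16 * (ndig q N)%:R * ln q%:R = ln ((q ^ (16 * ndig q N))%:R : R).
  by rewrite natrX lnXn // -[RHS]mulr_natl natrM.
by rewrite ler_ln ?posrE ?ltr0n ?expn_gt0 ?ler_nat ?(ltnW q_gt1) // ltnW.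
Qed.

(** Both the range of [k] and the required gap grow with $\log m$, so parameters chosen for [N]
    serve every [m] up to [N]. The 16 digits per unit of [ndig] give $c_2 = 1/16$. *)
Lemma all_good_valuation_gap (R : realType) (N K m : nat) :
  (0 < m <= N)%N -> (0 < K)%N ->
  (forall k : nat, k%:R <= expR (64^-1 * Num.sqrt (ln (N%:R : R))) -> (k <= K)%N) ->
  all_good N K m -> valuation_gap_set (64^-1 : R) 16^-1 m.
Proof.
move=> /andP[m_gt0 le_mN] K_gt0 leK good_m; have N_gt0 := leq_trans m_gt0 le_mN.
have le_ln : ln (m%:R : R) <= ln N%:R by rewrite ler_ln ?posrE ?ltr0n ?ler_nat.
split=> // k le_k p p_pr; have p_gt1 := prime_gt1 p_pr.
have le_kK : (k <= K)%N.
  apply/leK/(le_trans le_k); rewrite ler_expR ler_wpM2l //.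
  by rewrite ler_wsqrtr.
case: (leqP p (2 * k)) => [le_p|lt_k]; last first.
  by rewrite mulr0 subr_ge0 ler_nat logn_bin_small.
have := all_good_gap N K m k p N_gt0 le_kK p_pr le_p good_m.
rewrite -(ler_nat R) natrD mulr1.
have lnp_gt0 : 0 < ln (p%:R : R) by rewrite ln_gt0 // ltr1n.
have : 16^-1 * (ln m%:R / ln p%:R) <= (ndig p N)%:R :> R.
  rewrite mulrA ler_pdivrMr //.
  have := ln_le_ndig R p N p_gt1 N_gt0; lra.
lra.
Qed.

Lemma count_not_valuation_gap (R : realType) (N K : nat) :
  (0 < N)%N -> (0 < K)%N ->
  (forall k : nat, k%:R <= expR (64^-1 * Num.sqrt (ln (N%:R : R))) -> (k <= K)%N) ->
  (2 ^ ndig (2 * K) N *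
     (N - counting_function (valuation_gap_set (64^-1 : R) 16^-1) N)
   <= (2 * K) ^ 18 * N)%N.
Proof.
move=> N_gt0 K_gt0 leK; set S := valuation_gap_set _ _.
apply: leq_trans (count_not_all_good N K N_gt0 K_gt0).
rewrite leq_mul2l leq_subLR; apply/orP; right.
have {1}-> : N = (\sum_(1 <= m < N.+1) 1)%N by rewrite sum_nat_const_nat subn1 muln1.
rewrite -big_split /= big_nat_cond [leqRHS]big_nat_cond; apply: leq_sum => m.
rewrite andbT => /andP[m_gt0 le_m].
case: (boolP (all_good N K m)) => good_m; last by rewrite addn1.
rewrite addn0; have : S m by apply: all_good_valuation_gap good_m; rewrite ?m_gt0.
by move/mem_set ->.
Qed.

(** With $K = \lfloor e^y \rfloor$ and $\log N = (64y)^2$, the exponent [mu] is at least $128y$, so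
    $2^\mu \ge e^{64y}$ while $(2K)^{18} \le e^{36y}$. The exceptional proportion is thus at most
    $e^{-28y} \le 1/y$; $c_1 = 1/64$ leaves this margin. *)
Lemma density_error (R : realType) (N : nat) (y : R) :
  (0 < N)%N -> y = 64^-1 * Num.sqrt (ln N%:R) -> 1 <= y ->
  `|1 - (counting_function (valuation_gap_set (64^-1 : R) 16^-1) N)%:R / N%:R| <= y^-1.
Proof.
move=> N_gt0 y_def y_ge1; set c := counting_function _ _.
pose K := Num.truncn (expR y).
have K_gt0 : (0 < K)%N.
  by rewrite truncn_ge_nat ?expR_ge0 // -expR0 ler_expR; lra.
have leK (k : nat) : k%:R <= expR (64^-1 * Num.sqrt (ln (N%:R : R))) -> (k <= K)%N.
  by rewrite -y_def truncn_ge_nat ?expR_ge0.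
have := count_not_valuation_gap R N K N_gt0 K_gt0 leK.
rewrite -/c; set mu := ndig _ _ => bad.
have le_c : (c <= N)%N.
  apply: leq_trans (_ : \sum_(1 <= m < N.+1) 1 <= _)%N.
    by apply: leq_sum => m _; case: (m \in _).
  by rewrite sum_nat_const_nat subn1 muln1.
have N_pos : 0 < N%:R :> R by rewrite ltr0n.
have KE : (2 * K)%:R <= expR (2 * y) :> R.
  rewrite natrM (_ : 2 * y = y + y); last by ring.
  (* Here $2 \le 1 + y \le e^y$ uses $y \ge 1$. *)
  rewrite expRD ler_pM //; first by apply: le_trans (expR_ge1Dx _); lra.
  by rewrite truncn_le ?expR_ge0.
have lnK : ln (2 * K)%:R <= 2 * y.
  by rewrite -[leRHS]expRK ler_ln ?posrE ?expR_gt0 // ltr0n; lia.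
have lnN : ln N%:R = (64 * y) ^+ 2.
  rewrite y_def mulrA divff // mul1r sqr_sqrtr // ln_ge0 //.
  by rewrite ler1n.
have mu_ge : 128 * y <= mu%:R.
  have := ln_le_ndig R (2 * K) N; rewrite -/mu lnN => /(_ ltac:(lia) N_gt0).
  have : mu%:R * ln (2 * K)%:R <= mu%:R * (2 * y) by rewrite ler_wpM2l.
  move=> h1 h2; have : 128 * y * y <= mu%:R * y by nra.
  by rewrite ler_pM2r //; lra.
have mu_exp : expR (64 * y) <= (2 ^ mu)%:R.
  (* Inverted, this is $e^{-1/2} \ge 1 - 1/2$. *)
  have half : expR (2^-1) <= 2 :> R.
    rewrite -[leLHS]invrK -expRN -[leRHS]invrK lef_pV2 ?posrE ?expR_gt0 ?invr_gt0 //.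
    by apply: le_trans (expR_ge1Dx _); lra.
  rewrite natrX; apply: le_trans (_ : expR 2^-1 ^+ mu <= _); last first.
    by rewrite lerXn2r ?nnegrE ?expR_ge0.
  by rewrite -expRM_natl ler_expR -mulr_natl; lra.
have K18 : ((2 * K) ^ 18)%:R <= expR (36 * y) :> R.
  rewrite natrX (_ : 36 * y = 18%:R * (2 * y)); last by ring.
  by rewrite expRM_natl lerXn2r ?nnegrE ?expR_ge0.
have {bad} bad : expR (64 * y) * (N%:R - c%:R) <= expR (36 * y) * N%:R.
  apply: le_trans (_ : (2 ^ mu)%:R * (N%:R - c%:R) <= _).
    by rewrite ler_wpM2r // subr_ge0 ler_nat.
  apply: le_trans (_ : ((2 * K) ^ 18)%:R * N%:R <= _); last by rewrite ler_wpM2r.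
  by rewrite -natrB // -!natrM ler_nat.
have y_gt0 : 0 < y by lra.
have -> : 1 - c%:R / N%:R = (N%:R - c%:R) / N%:R :> R by field; rewrite gt_eqF.
rewrite ger0_norm; last by rewrite divr_ge0 ?subr_ge0 ?ler_nat ?ltW.
rewrite ler_pdivrMr // -(ler_pM2l (expR_gt0 (64 * y))) (le_trans bad) //.
rewrite mulrA ler_wpM2r // ler_pdivlMr //.
rewrite (_ : 64 * y = 36 * y + 28 * y); last by ring.
rewrite expRD ler_wpM2l ?expR_ge0 // (le_trans _ (expR_ge1Dx _)) //; lra.
Qed.

Theorem theorem2 (R : realType) :
  exists c1 c2 : R, 0 < c1 /\ 0 < c2 /\
    has_asymptotic_density (valuation_gap_set c1 c2) (1 : R).
Proof.
exists 64^-1, 16^-1; split; first by rewrite invr_gt0.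
split; first by rewrite invr_gt0.
apply/cvgrPdist_le => e e_gt0.
(* The summand 1 secures the hypothesis $y \ge 1$ of [density_error], and [e^-1] makes its bound
   $1/y$ at most [e]. *)
pose Y := 1 + e^-1; have Y_ge1 : 1 <= Y by rewrite lerDl invr_ge0 ltW.
near=> N.
(* This threshold is where $\sqrt{\log N}/64$ reaches [Y]. *)
have NE : expR ((64 * Y) ^+ 2) <= N%:R.
  by near: N; exact: nbhs_infty_ger.
have N_gt0 : (0 < N)%N by rewrite -(ltr0n R); apply: lt_le_trans NE; apply: expR_gt0.
set y := 64^-1 * Num.sqrt (ln (N%:R : R)).
have le_Yy : Y <= y.
  rewrite /y ler_pdivlMl // -[leLHS]ger0_norm; last by lra.
  rewrite -sqrtr_sqr ler_wsqrtr // -[leLHS]expRK.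
  by rewrite ler_ln ?posrE ?expR_gt0 ?ltr0n.
apply: le_trans (density_error R N y N_gt0 erefl _) _; first by lra.
rewrite -[leRHS]invrK lef_pV2 ?posrE ?invr_gt0 //; last by lra.
by apply: le_trans le_Yy; rewrite lerDr.
Unshelve. all: by end_near.
Qed.
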